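(* Let $n\ge 2$ and $1\le p\le 2n-1$. Then \[ \mathrm{FPdim}(\tau_p)= \begin{cases} 2^{\frac{2p}{2n-1}} & \text{if } 1\le p<n,\\[3pt] 2^{\frac{2p}{2n-1}-1} & \text{if } n\le p<2n-1,\\[3pt] 1 & \text{if } p=2n-1. \end{cases} \]
   Context: Let $n\ge 2$ and let $\mathrm{OG}=\mathrm{OG}(1,2n+1)\subset\mathbb{P}(\mathbb{C}^{2n+1})$ be the $(2n-1)$-dimensional quadric of isotropic lines through the origin in $\mathbb{C}^{2n+1}$ for the symmetric form $(a,b)=\sum_{i=1}^{2n+1}a_i b_{2n+2-i}$; equivalently, the zero locus of $v_{n+1}^2+2\sum_{i=1}^n v_iv_{2n+2-i}$. For $0\le p\le n-1$ let $X(p)=\mathrm{OG}\cap\{v_1=\dots=v_p=0\}$ and for $n\le p\le 2n-1$ let $X(p)=\mathrm{OG}\cap\{v_1=\dots=v_{p+1}=0\}$; these are the Schubert varieties, $X(p)$ has codimension $p$ in $\mathrm{OG}$, and $\tau_p:=[X(p)]$ is its Schubert class. The Poincaré dual of $\tau_j$ is $\tau_{2n-1-j}$. The (small) quantum cohomology ring $(\mathrm{QH}^*(\mathrm{OG}),\star)$ is the graded commutative associative $\mathbb{Z}[q]$-algebra with $\mathbb{Z}[q]$-basis $\tau_0,\dots,\tau_{2n-1}$, $\deg\tau_p=p$, $\deg q=2n-1$, and unit $\tau_0$, with product $\tau_p\star\tau_i=\sum_{j,d_0\ge 0}c_{p,i}^{j,d_0}q^{d_0}\tau_j$, where $c_{p,i}^{j,d_0}$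 is the Gromov–Witten invariant enumerating degree $d_0$ rational curves meeting general translates of $X(p)$, $X(i)$, $X(2n-1-j)$. It satisfies the known quantum Chevalley formula: $\tau_1\star\tau_p=\tau_{p+1}$ for $0\le p\le n-2$; $\tau_1\star\tau_{n-1}=2\tau_n$; $\tau_1\star\tau_p=\tau_{p+1}$ for $n\le p\le 2n-3$; $\tau_1\star\tau_{2n-2}=\tau_{2n-1}+q\tau_0$; $\tau_1\star\tau_{2n-1}=q\tau_1$. Together with associativity and the unit $\tau_0$, this determines the product. $H^\bullet(\mathrm{OG})$ denotes the specialization of $\mathrm{QH}^*(\mathrm{OG})$ at $q=1$, regarded as a $2n$-dimensional complex vector space with basis $\tau_0,\dots,\tau_{2n-1}$, and $A(\tau_p)$ is the endomorphism $y\mapsto(\tau_p\star y)|_{q=1}$ of $H^\bullet(\mathrm{OG})$. The Frobenius–Perron dimension of $\tau_p$ is $\mathrm{FPdim}(\tau_p):=\max\{|\delta|:\delta\text{ is an eigenvalue of }A(\tau_p)\}$. *)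

(* Defs.v *)
From HB Require Import structures.
From mathcomp Require Import all_boot all_order all_algebra.
From mathcomp Require Import all_classical all_reals all_analysis.
From mathcomp Require Import complex.
From mathcomp Require mpoly.

Set Implicit Arguments.
Unset Strict Implicit.
Unset Printing Implicit Defensive.

Import Order.TTheory GRing.Theory Num.Theory.
Local Open Scope classical_set_scope.
Local Open Scope ring_scope.

(** * The quadric OG(1, 2n+1) and its Schubert varieties

    Coordinates are indexed from 0: the coordinate v_k of the mathematics is
    [v 0 i] with [i = k - 1], so that [rev_ord] is k |-> 2n + 2 - k.
    Subvarieties of projective space are represented by their cones, i.e. by
    sets of nonzero vectors; the group acts on row vectors on the right. *)

Definition bform (K : comNzRingType) (n : nat)
    (a b : 'rV[K]_((2 * n).+1)) : K :=
  \sum_(i < (2 * n).+1) a 0 i * b 0 (rev_ord i).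

Definition OG (K : fieldType) (n : nat) : set 'rV[K]_((2 * n).+1) :=
  [set v | v != 0 /\ bform v v = 0].

Definition schubert (K : fieldType) (n p : nat) : set 'rV[K]_((2 * n).+1) :=
  [set v | OG v /\
     forall i : 'I_(2 * n).+1, (i < (if (p < n)%N then p else p.+1))%N ->
       v 0 i = 0].

Definition SO (K : fieldType) (n : nat) : set 'M[K]_((2 * n).+1) :=
  [set g | (forall a b, bform (a *m g) (b *m g) = bform a b) /\ \det g = 1].

Definition translate (K : fieldType) (n : nat)
    (X : set 'rV[K]_((2 * n).+1)) (g : 'M[K]_((2 * n).+1)) :
    set 'rV[K]_((2 * n).+1) :=
  [set v *m g | v in X].

(** * Rational curves

    A morphism P^1 -> OG of degree d is given by 2n+1 binary forms of degree d
    without common zero, satisfying the equation of OG, up to a common nonzero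
    scalar. The form \sum_m a_m s^(d-m) t^m is encoded by the polynomial
    \sum_m a_m X^m; its value at infinity (s = 0) is the coefficient a_d. *)

Definition curve (K : fieldType) (n d : nat) :
    set 'rV[{poly K}]_((2 * n).+1) :=
  [set f : 'rV[{poly K}]_((2 * n).+1) | [/\ forall i, (size (f 0%R i) <= d.+1)%N,
               forall z : K, exists i, (f 0 i).[z] != 0,
               exists i, (f 0 i)`_d != 0
             & bform f f = 0]].

Definition at_point (K : fieldType) (n : nat)
    (f : 'rV[{poly K}]_((2 * n).+1)) (z : K) : 'rV[K]_((2 * n).+1) :=
  \row_i (f 0 i).[z].

Definition at_infinity (K : fieldType) (n d : nat)
    (f : 'rV[{poly K}]_((2 * n).+1)) : 'rV[K]_((2 * n).+1) :=
  \row_i (f 0 i)`_d.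

Definition same_curve (K : fieldType) (n : nat)
    (f f' : 'rV[{poly K}]_((2 * n).+1)) : Prop :=
  exists2 a : K, a != 0 & f' = a%:P *: f.

Definition curves_through (K : fieldType) (n d : nat)
    (X Y Z : set 'rV[K]_((2 * n).+1)) : set 'rV[{poly K}]_((2 * n).+1) :=
  [set f : 'rV[{poly K}]_((2 * n).+1) | [/\ curve d f, X (at_point f 0), Y (at_point f 1)
             & Z (at_infinity d f)]].

Definition curve_count (K : fieldType) (n : nat)
    (S : set 'rV[{poly K}]_((2 * n).+1)) (N : nat) : Prop :=
  exists F : 'I_N -> 'rV[{poly K}]_((2 * n).+1),
    [/\ forall a, S (F a),
        forall a b, same_curve (F a) (F b) -> a = b
      & forall f, S f -> exists a, same_curve (F a) f].

(** * Gromov-Witten invariants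

    "For general (g1, g2, g3) in SO^3": on the nonvanishing locus in SO^3 of
    some polynomial in the matrix entries that is not identically zero on
    SO^3. As SO^3 is an irreducible affine variety, these loci are a basis of
    its dense open subsets, and the generic count is unique. *)

Definition entries (K : fieldType) (N : nat) (g : 'I_3 -> 'M[K]_N)
    (k : 'I_#|{: 'I_3 * 'I_N * 'I_N}|) : K :=
  let: (a, i, j) := enum_val k in g a i j.

Definition for_general_translates (K : fieldType) (n : nat)
    (Q : ('I_3 -> 'M[K]_((2 * n).+1)) -> Prop) : Prop :=
  exists P : mpoly.mpoly
      #|{: 'I_3 * 'I_(2 * n).+1 * 'I_(2 * n).+1}| K,
    (exists2 g : 'I_3 -> 'M[K]_((2 * n).+1),
       (forall a, SO (g a)) & mpoly.meval (entries g) P != 0) /\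
    (forall g : 'I_3 -> 'M[K]_((2 * n).+1),
       (forall a, SO (g a)) -> mpoly.meval (entries g) P != 0 -> Q g).

Definition is_GW_number (K : fieldType) (n d p i k N : nat) : Prop :=
  for_general_translates (fun g : 'I_3 -> 'M[K]_((2 * n).+1) =>
    curve_count
      (curves_through d (translate (schubert p) (g 0))
                        (translate (schubert i) (g 1))
                        (translate (schubert k) (g 2%:R))) N).

(* The dimension condition
     p + i + (2n-1-j) = dim OG + d * deg q,   dim OG = deg q = 2n-1,
   reads p + i = j + d(2n-1); the invariant vanishes when it fails. *)
Definition GW (K : fieldType) (n p i j d : nat) : nat :=
  if (p + i == j + d * (2 * n - 1))%N
  then xget 0%N [set N | is_GW_number K n d p i (2 * n - 1 - j) N]
  else 0%N.

(** * Quantum cohomology: the free Z[q]-module on tau_0, ..., tau_(2n-1) *)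

Definition QH (n : nat) : Type := 'rV[{poly int}]_(2 * n).

Definition q : {poly int} := 'X.

Definition tau (n p : nat) : 'rV[{poly int}]_(2 * n) :=
  \row_(j < 2 * n) (j == p :> nat)%:R.

(* By the dimension condition in [GW], only d <= p + i contributes. *)
Definition tau_prod (K : fieldType) (n p i : nat) : 'rV[{poly int}]_(2 * n) :=
  \sum_(j < 2 * n) \sum_(d < (p + i).+1)
    ((GW K n p i j d)%:R * q ^+ d) *: tau n j.

Definition qmul (K : fieldType) (n : nat) (x y : QH n) : QH n :=
  \sum_(p < 2 * n) \sum_(i < 2 * n) (x 0 p * y 0 i) *: tau_prod K n p i.

Definition quantum_Chevalley (K : fieldType) (n : nat) : Prop :=
  let star := @qmul K n in
  let t := tau n in
  [/\ forall p, (p.+2 <= n)%N -> star (t 1%N) (t p) = t p.+1,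
      star (t 1%N) (t n.-1) = 2%:R *: t n,
      forall p, (n <= p)%N -> (p <= 2 * n - 3)%N ->
        star (t 1%N) (t p) = t p.+1,
      star (t 1%N) (t (2 * n - 2)%N) = t (2 * n - 1)%N + q *: t 0%N
    & star (t 1%N) (t (2 * n - 1)%N) = q *: t 1%N].

(** * Frobenius-Perron dimension *)

(* Matrix of y |-> (tau_p * y)|_{q=1} in the basis tau_0, ..., tau_(2n-1);
   endomorphisms act on row vectors, so row i is the image of tau_i. *)
Definition A (R : realType) (n p : nat) : 'M[R[i]]_(2 * n) :=
  \matrix_(i, j) ((qmul R[i] (tau n p) (tau n i)) 0 j).[1]%:~R.

Definition eigenvalue_moduli (R : realType) (m : nat) (M : 'M[R[i]]_m) :
    set R :=
  [set complex.Re `|delta| | delta in [set delta | eigenvalue M delta]].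

(* [xget 0] selects the maximum, and would return 0 if there were none. *)
Definition FPdim (R : realType) (n p : nat) : R :=
  xget 0 [set x | eigenvalue_moduli (A R n p) x /\
                 ubound (eigenvalue_moduli (A R n p)) x].

(* Main.v *)
Require Import Defs.
From mathcomp Require Import all_boot all_order all_algebra.
From mathcomp Require Import all_classical all_reals all_analysis.
From mathcomp Require Import complex.
From mathcomp Require Import ring zify.

Import Order.TTheory GRing.Theory Num.Theory.
Local Open Scope ring_scope.

(** The idea is that, at q = 1, everything is governed by the single operator
    M of multiplication by tau_1.  The Chevalley formula expresses the powers
    of tau_1 in the Schubert basis: tau_p is tau_1^p for p < n and half of it
    for n <= p < 2n - 1, then tau_1^(2n-1) = 2 (tau_(2n-1) + 1), and one more
    factor tau_1 gives tau_1^(2n) = 4 tau_1.  By associativity the same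
    relations hold between the multiplication operators
    ([op_tau_low], [op_tau_high], [op_tau_top], [op_tau1_expS]).

    Let alpha be the positive real number with alpha^(2n-1) = 4.  The equation
    M^(2n) = 4 M leaves 0 and the complex numbers of modulus alpha as the only
    possible eigenvalues of M, and likewise, for B = c M^p, it gives
    B^(2n) = (c alpha^p)^(2n-1) B, so a nonzero eigenvalue of B has modulus
    c alpha^p ([norm_eigenvalue]).  Moreover alpha itself is an eigenvalue of
    M: the vector obtained by applying (M^(2n) - 4 M) / (M - alpha) to tau_0
    is killed by M - alpha, and it is nonzero because its tau_(2n-1)-coordinate
    is 2 ([op_tau1_eigenvector]).  This vector is an eigenvector of B for
    c alpha^p, so that c alpha^p is the maximum.

    The point class T = tau_(2n-1) acts by M^(2n-1) / 2 - 1, whose square is 1;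
    all its eigenvalues have modulus 1, and the same vector is an eigenvector
    for 4 / 2 - 1 = 1. *)

(** * Scaling in the ring of square matrices *)

(** The size 2n is not of the form m.+1, where square matrices are canonically
    an algebra; these rules of an algebra hold in every size. *)
Lemma scale_mulmxl (K : fieldType) (m : nat) (a : K) (M N : 'M[K]_m) :
  a *: M * N = a *: (M * N).
Proof. by rewrite -mulmxE scalemxAl. Qed.

Lemma scale_mulmxr (K : fieldType) (m : nat) (a : K) (M N : 'M[K]_m) :
  M * (a *: N) = a *: (M * N).
Proof. by rewrite -mulmxE scalemxAr. Qed.

Lemma scale_exprmx (K : fieldType) (m k : nat) (a : K) (M : 'M[K]_m) :
  (a *: M) ^+ k = a ^+ k *: M ^+ k.
Proof.
elim: k => [|k IH]; first by rewrite !expr0 scale1r.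
by rewrite !exprS IH scale_mulmxl scale_mulmxr scalerA.
Qed.

(** * Multiplication operators at q = 1 *)

Definition coef_at_q1 (K : fieldType) : {rmorphism {poly int} -> K} :=
  intr \o horner_eval 1.

Definition at_q1 (K : fieldType) (m : nat) (y : 'rV[{poly int}]_m) : 'rV[K]_m :=
  map_mx (coef_at_q1 K) y.

(** The matrix of quantum multiplication by an arbitrary class, not only by a
    Schubert class: this makes the operator linear and multiplicative in the
    class, which is what transports the Chevalley formula to operators. *)
Definition op (K : fieldType) (n : nat) (x : QH n) : 'M[K]_(2 * n) :=
  \matrix_(i, j) coef_at_q1 K ((qmul K x (tau n i)) 0 j).

Lemma qmul_tauE (K : fieldType) (n : nat) (x : QH n) (i : 'I_(2 * n)) :
  qmul K x (tau n i) = \sum_(p < 2 * n) x 0 p *: tau_prod K n p i.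
Proof.
apply: eq_bigr => p _; rewrite (bigD1 i) //= big1 ?addr0 => [|k ki].
  by rewrite mxE eqxx mulr1.
by rewrite mxE -[_ == _ :> nat]/(k == i) (negPf ki) mulr0 scale0r.
Qed.

Lemma qmul_sumr (K : fieldType) (n : nat) (x y : QH n) :
  qmul K x y = \sum_(i < 2 * n) y 0 i *: qmul K x (tau n i).
Proof.
rewrite /qmul exchange_big; apply: eq_bigr => i _.
rewrite -/(qmul K x (tau n i)) qmul_tauE scaler_sumr.
by apply: eq_bigr => p _; rewrite scalerA mulrC.
Qed.

Lemma at_q1_qmul (K : fieldType) (n : nat) (x y : QH n) :
  at_q1 K (2 * n) (qmul K x y) = at_q1 K (2 * n) y *m op K n x.
Proof.
apply/rowP => j; rewrite !mxE qmul_sumr summxE rmorph_sum.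
by apply: eq_bigr => i _; rewrite !mxE rmorphM.
Qed.

Lemma row_op (K : fieldType) (n : nat) (x : QH n) (i : 'I_(2 * n)) :
  row i (op K n x) = at_q1 K (2 * n) (qmul K x (tau n i)).
Proof. by apply/rowP => j; rewrite !mxE. Qed.

Lemma op_qmul (K : fieldType) (n : nat) (x y : QH n)
    (star_assoc : associative (@qmul K n)) :
  op K n (qmul K x y) = op K n y * op K n x.
Proof.
apply/row_matrixP => i; rewrite -mulmxE row_mul !row_op -star_assoc.
exact: at_q1_qmul.
Qed.

Lemma opD (K : fieldType) (n : nat) (x y : QH n) :
  op K n (x + y) = op K n x + op K n y.
Proof.
apply/matrixP => i j; rewrite !mxE !qmul_tauE -rmorphD !summxE -big_split /=.
by congr (coef_at_q1 K _); apply: eq_bigr => p _; rewrite !mxE mulrDl.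
Qed.

Lemma opZ (K : fieldType) (n : nat) (a : {poly int}) (x : QH n) :
  op K n (a *: x) = coef_at_q1 K a *: op K n x.
Proof.
apply/matrixP => i j; rewrite !mxE !qmul_tauE -rmorphM !summxE mulr_sumr.
by congr (coef_at_q1 K _); apply: eq_bigr => p _; rewrite !mxE mulrA.
Qed.

Lemma at_q1_tau (K : fieldType) (n : nat) (i : 'I_(2 * n)) :
  at_q1 K (2 * n) (tau n i) = delta_mx 0 i.
Proof. by apply/rowP => j; rewrite !mxE rmorph_nat. Qed.

Lemma op_unit (K : fieldType) (n : nat)
    (star_unit : left_id (tau n 0) (@qmul K n)) :
  op K n (tau n 0) = 1.
Proof.
apply/row_matrixP => i; rewrite row_op star_unit at_q1_tau.
by rewrite rowE mulmx1.
Qed.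

Lemma coef_at_q1_q (K : fieldType) : coef_at_q1 K q = 1.
Proof. by rewrite /coef_at_q1 /= /horner_eval hornerX. Qed.

(** * Powers of the hyperplane class *)

Lemma op_tau_low (K : fieldType) (n p : nat)
    (star_assoc : associative (@qmul K n))
    (star_unit : left_id (tau n 0) (@qmul K n))
    (chevalley : quantum_Chevalley K n) :
  (p < n)%N -> op K n (tau n 1) ^+ p = op K n (tau n p).
Proof.
case: chevalley => low _ _ _ _.
elim: p => [|p IH] pn; first by rewrite expr0 op_unit.
by rewrite exprSr IH ?(ltnW pn) // -op_qmul // low.
Qed.

Lemma op_tau_high (K : fieldType) (n p : nat) (hn : (2 <= n)%N)
    (star_assoc : associative (@qmul K n))
    (star_unit : left_id (tau n 0) (@qmul K n))
    (chevalley : quantum_Chevalley K n) :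
  (n <= p)%N -> (p < 2 * n - 1)%N ->
  op K n (tau n 1) ^+ p = 2 *: op K n (tau n p).
Proof.
case: (chevalley) => _ mid high _ _.
elim: p => [|p IH] np pn; first by lia.
rewrite exprSr; have [le_np|lt_pn] := leqP n p; last first.
  have -> : p = n.-1 by lia.
  rewrite op_tau_low ?(prednK (ltnW hn)) //.
  by rewrite -op_qmul // mid opZ rmorph_nat.
rewrite IH //; last by lia.
by rewrite scale_mulmxl -op_qmul // high //; lia.
Qed.

(** The q in tau_1 * tau_(2n-2) = tau_(2n-1) + q tau_0 becomes the summand 1. *)
Lemma op_tau_top (K : fieldType) (n : nat) (hn : (2 <= n)%N)
    (star_assoc : associative (@qmul K n))
    (star_unit : left_id (tau n 0) (@qmul K n))
    (chevalley : quantum_Chevalley K n) :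
  op K n (tau n 1) ^+ (2 * n - 1) = 2 *: (op K n (tau n (2 * n - 1)) + 1).
Proof.
case: (chevalley) => _ _ _ top _.
rewrite (_ : 2 * n - 1 = (2 * n - 2).+1)%N; last by lia.
rewrite exprSr op_tau_high //; try lia.
rewrite scale_mulmxl -op_qmul // top opD opZ coef_at_q1_q scale1r op_unit //.
by congr (_ *: (op K n (tau n _) + _)); lia.
Qed.

(** Both summands of tau_1^(2n-1) = 2 (tau_(2n-1) + 1) return tau_1 when
    multiplied by tau_1, hence 4 = 2 + 2. *)
Lemma op_tau1_expS (K : fieldType) (n : nat) (hn : (2 <= n)%N)
    (star_assoc : associative (@qmul K n))
    (star_unit : left_id (tau n 0) (@qmul K n))
    (chevalley : quantum_Chevalley K n) :
  op K n (tau n 1) ^+ (2 * n - 1).+1 = 4 *: op K n (tau n 1).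
Proof.
case: (chevalley) => _ _ _ _ wrap.
rewrite exprSr op_tau_top // scale_mulmxl mulrDl mul1r -op_qmul // wrap opZ.
by rewrite coef_at_q1_q scale1r -mulr2n -scaler_nat scalerA -natrM.
Qed.

(** Since tau_p * tau_0 = tau_p, the row of tau_0 in the operator of tau_p is
    the p-th basis vector; among the powers of tau_1 up to the (2n-1)-st, only
    the last one involves tau_(2n-1). *)
Lemma op_tau1_exp_corner (K : fieldType) (n k : nat) (hn : (2 <= n)%N)
    (i0 i1 : 'I_(2 * n))
    (star_assoc : associative (@qmul K n))
    (star_comm : commutative (@qmul K n))
    (star_unit : left_id (tau n 0) (@qmul K n))
    (chevalley : quantum_Chevalley K n) :
  i0 = 0%N :> nat -> i1 = (2 * n - 1)%N :> nat -> (k <= 2 * n - 1)%N ->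
  (op K n (tau n 1) ^+ k) i0 i1 = ((k == 2 * n - 1)%N * 2)%:R.
Proof.
move=> e0 e1 kn.
have corner l : op K n (tau n l) i0 i1 = (2 * n - 1 == l)%N%:R.
  by rewrite mxE e0 star_comm star_unit mxE e1 rmorph_nat.
have [lt_kn|] := ltnP k (2 * n - 1).
  rewrite (ltn_eqF lt_kn); have [lt|le] := ltnP k n.
    by rewrite op_tau_low // corner (gtn_eqF lt_kn).
  by rewrite op_tau_high // mxE corner (gtn_eqF lt_kn) mulr0.
move=> nk; have -> : k = (2 * n - 1)%N by lia.
rewrite op_tau_top // mxE mxE corner eqxx [X in _ + X]mxE.
have -> : (i0 == i1) = false by apply/eqP => /(congr1 val) /=; lia.
by rewrite addr0 mulr1.
Qed.

(** * Eigenvalues *)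

(** The eigenvector is tau_0 multiplied by the cofactor
    (X^k.+1 - alpha^k X) / (X - alpha), where k = 2n - 1. *)
Lemma op_tau1_eigenvector (K : numFieldType) (n : nat) (alpha : K)
    (hn : (2 <= n)%N)
    (star_assoc : associative (@qmul K n))
    (star_comm : commutative (@qmul K n))
    (star_unit : left_id (tau n 0) (@qmul K n))
    (chevalley : quantum_Chevalley K n) :
  alpha ^+ (2 * n - 1) = 4 ->
  exists2 v : 'rV[K]_(2 * n),
    v *m op K n (tau n 1) = alpha *: v & v != 0.
Proof.
move=> alphaE.
have [i0 e0] : exists i : 'I_(2 * n), i = 0%N :> nat.
  by have lt0 : (0 < 2 * n)%N by [lia]; exists (Ordinal lt0).
have [i1 e1] : exists i : 'I_(2 * n), i = (2 * n - 1)%N :> nat.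
  by have lt1 : (2 * n - 1 < 2 * n)%N by [lia]; exists (Ordinal lt1).
set M := op K n (tau n 1).
pose C := \sum_(k < 2 * n - 1) alpha ^+ (2 * n - 1 - k.+1) *: M ^+ k.+1.
have CM : C * M = alpha *: C.
  (* The difference telescopes to M^(2n) - alpha^(2n-1) M = 0. *)
  apply/eqP; rewrite -subr_eq0 mulr_suml scaler_sumr -sumrB.
  have -> : \sum_(k < 2 * n - 1)
      (alpha ^+ (2 * n - 1 - k.+1) *: M ^+ k.+1 * M
       - alpha *: (alpha ^+ (2 * n - 1 - k.+1) *: M ^+ k.+1)) =
    \sum_(0 <= k < 2 * n - 1) (alpha ^+ (2 * n - 1 - k.+1) *: M ^+ k.+2
       - alpha ^+ (2 * n - 1 - k) *: M ^+ k.+1).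
    rewrite big_mkord; apply: eq_bigr => k _.
    rewrite scale_mulmxl -exprSr scalerA -exprS.
    by congr (_ - alpha ^+ _ *: _); have := ltn_ord k; lia.
  rewrite (telescope_sumr
    (fun k => alpha ^+ (2 * n - 1 - k) *: M ^+ k.+1)) //.
  by rewrite subnn subn0 expr0 scale1r expr1 alphaE op_tau1_expS // subrr.
exists (row i0 C).
  by rewrite -row_mul mulmxE CM; apply/rowP => j; rewrite !mxE.
apply/eqP => /rowP /(_ i1) /eqP; apply/negP.
rewrite !mxE summxE (_ : 2 * n - 1 = (2 * n - 2).+1)%N; last by lia.
rewrite big_ord_recr /= big1 => [|k _].
  rewrite mxE (@op_tau1_exp_corner _ _ _ hn) //=; try lia.
  have -> : ((2 * n - 2).+1 == 2 * n - 1)%N by lia.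
  by rewrite subnn expr0 add0r mul1r pnatr_eq0.
have := ltn_ord k => ltk.
rewrite mxE (@op_tau1_exp_corner _ _ _ hn) //=; try lia.
rewrite (_ : (_ == _) = false) ?mulr0 //; apply/eqP; lia.
Qed.

Lemma eigenvector_exp (K : fieldType) (m k : nat) (M : 'M[K]_m) (a : K)
    (v : 'rV[K]_m) :
  v *m M = a *: v -> v *m M ^+ k = a ^+ k *: v.
Proof.
move=> vM; elim: k => [|k IH]; first by rewrite !expr0 mulmx1 scale1r.
by rewrite exprS -mulmxE mulmxA vM -scalemxAl IH scalerA -exprS.
Qed.

(** On an eigenvector for d the relation reads d^(k+1) = mu^k d. *)
Lemma norm_eigenvalue (K : numFieldType) (m k : nat) (B : 'M[K]_m) (mu d : K) :
  (0 < k)%N -> 0 <= mu -> B ^+ k.+1 = mu ^+ k *: B ->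
  eigenvalue B d -> `|d| = 0 \/ `|d| = mu.
Proof.
move=> k0 mu0 BE /eigenvalueP[v vB v0].
have /eqP := eigenvector_exp K m k.+1 B d v vB.
rewrite BE -scalemxAr vB scalerA -subr_eq0 -scalerBl scaler_eq0 (negPf v0) orbF.
rewrite exprSr -mulrBl mulf_eq0 subr_eq0 => /orP[/eqP E|/eqP->]; last first.
  by left; rewrite normr0.
right; apply/eqP; rewrite -(eqrXn2 k0) ?normr_ge0 // -normrX -E.
by rewrite ger0_norm ?exprn_ge0.
Qed.

Lemma exprZ_relation (K : fieldType) (m k p : nat) (M : 'M[K]_m) (a c : K) :
  M ^+ k.+1 = a ^+ k *: M ->
  (c *: M ^+ p) ^+ k.+1 = (c * a ^+ p) ^+ k *: (c *: M ^+ p).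
Proof.
move=> ME; rewrite scale_exprmx -exprM mulnC exprM ME scale_exprmx !scalerA.
by rewrite exprMn -!exprM (mulnC k p) exprSr mulrAC.
Qed.

Local Notation "x %:C" := (real_complex _ x).

Lemma max_eigenvalue_modulus (R : realType) (m k : nat) (B : 'M[R[i]]_m)
    (mu : R) :
  (0 < k)%N -> 0 <= mu -> B ^+ k.+1 = mu%:C ^+ k *: B ->
  eigenvalue B mu%:C ->
  xget 0 [set x | eigenvalue_moduli B x /\ ubound (eigenvalue_moduli B) x]%classic
    = mu.
Proof.
move=> k0 mu0 BE muB.
have muC0 : 0 <= mu%:C by rewrite ler0c.
have mem : eigenvalue_moduli B mu.
  by exists mu%:C => //; rewrite ger0_norm.
have ub : ubound (eigenvalue_moduli B) mu.
  move=> _ [d dB <-].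
  by case: (norm_eigenvalue _ _ k B mu%:C d k0 muC0 BE dB) => ->.
case: xgetP => [x _ [x_mem x_ub]|/(_ mu) []]; last by split.
by apply/le_anti; rewrite (ub _ x_mem) (x_ub _ mem).
Qed.

Theorem corollary1p2 (R : realType) (n p : nat)
    (hn : (2 <= n)%N) (hp1 : (1 <= p)%N) (hp2 : (p <= 2 * n - 1)%N)
    (star_assoc : associative (@qmul R[i] n))
    (star_comm : commutative (@qmul R[i] n))
    (star_unit : left_id (tau n 0) (@qmul R[i] n))
    (chevalley : quantum_Chevalley R[i] n) :
  FPdim R n p =
    if (p < n)%N then 2 `^ ((2 * p)%:R / (2 * n - 1)%:R)
    else if (p < 2 * n - 1)%N then 2 `^ ((2 * p)%:R / (2 * n - 1)%:R - 1)
    else 1.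
Proof.
have k0 : (0 < 2 * n - 1)%N by lia.
pose alpha : R := 2 `^ (2 / (2 * n - 1)%:R).
have alpha_exp l : alpha ^+ l = 2 `^ ((2 * l)%:R / (2 * n - 1)%:R).
  by rewrite -powR_mulrn ?powR_ge0 // -powRrM natrM mulrAC.
have alphaE : alpha ^+ (2 * n - 1) = 4.
  rewrite alpha_exp natrM mulfK ?pnatr_eq0 -?lt0n //.
  by rewrite powR_mulrn // -natrX.
have alphaCE : alpha%:C ^+ (2 * n - 1) = 4 :> R[i].
  by rewrite -rmorphXn alphaE rmorph_nat.
pose M := op R[i] n (tau n 1).
have ME : M ^+ (2 * n - 1).+1 = alpha%:C ^+ (2 * n - 1) *: M.
  by rewrite alphaCE op_tau1_expS.
have [v vM v0] := op_tau1_eigenvector _ _ _ hn star_assoc star_comm star_unit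
  chevalley alphaCE.
have main (c : R) : 0 <= c -> A R n p = c%:C *: M ^+ p ->
    FPdim R n p = c * alpha ^+ p.
  move=> c0 AE; rewrite /FPdim AE.
  apply: (@max_eigenvalue_modulus _ _ _ _ _ k0).
  - by rewrite mulr_ge0 ?exprn_ge0 ?powR_ge0.
  - by rewrite rmorphM rmorphXn; exact: exprZ_relation.
  - apply/eigenvalueP; exists v => //.
    rewrite -scalemxAr (eigenvector_exp _ _ _ _ _ _ vM) scalerA.
    by rewrite rmorphM rmorphXn.
have opA : A R n p = op R[i] n (tau n p) by [].
case: ltnP => [pn|np].
  by rewrite (main 1) ?mul1r ?alpha_exp // scale1r opA op_tau_low.
case: ltnP => [pn|pn].
  rewrite (main 2^-1) ?invr_ge0 //; last first.
    rewrite fmorphV rmorph_nat op_tau_high // scalerA mulVf ?scale1r //.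
  by rewrite powRB ?pnatr_eq0 ?implybT // powRr1 // alpha_exp mulrC.
have pE : p = (2 * n - 1)%N by lia.
have TE : A R n p = 2^-1 *: M ^+ p - 1.
  by rewrite pE op_tau_top // scalerA mulVf ?pnatr_eq0 // scale1r addrK.
apply: (@max_eigenvalue_modulus _ _ 2) => //.
- rewrite rmorph1 expr1n scale1r exprSr.
  suff -> : A R n p ^+ 2 = 1 by rewrite mul1r.
  (* With E = M^(2n-1), one has E^2 = 4 E, so (E/2 - 1)^2 = E - E + 1. *)
  have E2 : M ^+ p * M ^+ p = 4 *: M ^+ p.
    rewrite -exprD pE (_ : _ + _ = (2 * n - 1).+1 + (2 * n - 2))%N; last by lia.
    rewrite exprD ME alphaCE scale_mulmxl -exprS; congr (_ *: M ^+ _); lia.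
  rewrite TE sqrrB1 expr2 scale_mulmxl scale_mulmxr E2 !scalerA scalerMnl -scalerBl.
  by rewrite (_ : _ - _ = 0) ?scale0r ?add0r //; field.
- apply/eigenvalueP; exists v => //.
  rewrite TE mulmxBr -scalemxAr (eigenvector_exp _ _ _ _ _ _ vM) mulmx1 scalerA.
  rewrite pE alphaCE -[X in _ - X]scale1r -scalerBl.
  by congr (_ *: _); rewrite rmorph1; field.
Qed.
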